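(* Let $N\ge 2$ be an integer and $k$ a field whose characteristic $p$ is zero or greater than $N$. Let $\mathfrak{b}$ be the Borel subalgebra of $\mathfrak{sl}(N,k)$ consisting of all upper triangular matrices of trace zero, and let $\mathfrak{h}$ be the Cartan subalgebra of diagonal matrices of trace zero. Then for all $n$, $H^n(\mathfrak{b},k)\cong(\bigwedge^n\mathfrak{h})^*$, where $k$ is regarded as the trivial $\mathfrak{b}$-module.
   Context: $H^n(\mathfrak{b},k)$ denotes Lie algebra cohomology computed by the Chevalley-Eilenberg complex: $C^n(\mathfrak{b},k)$ is the space of $k$-linear maps $\bigwedge^n\mathfrak{b}\to k$ with, for trivial coefficients, $$(\delta F)(a_0,\dots,a_n)=\sum_{0\le i<j\le n}(-1)^{i+j}F([a_i,a_j],\dots,\hat a_i,\dots,\hat a_j,\dots),$$ and $H^n=\ker(\delta|_{C^n})/\delta(C^{n-1})$. $(\bigwedge^n\mathfrak{h})^*$ is the $k$-linear dual of the $n$th exterior power of $\mathfrak{h}$. *)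

(* Defs.v *)
From HB Require Import structures.
From mathcomp Require Import all_boot all_order all_algebra.
From mathcomp Require Import ssrAC perm.
From mathcomp Require Import boolp functions.
From mathcomp Require Import freeg.

Set Implicit Arguments.
Unset Strict Implicit.
Unset Printing Implicit Defensive.

Import GRing.Theory.
Local Open Scope ring_scope.
Local Open Scope quotient_scope.

Definition lmod_iso (k : fieldType) (U V : lmodType k) : Prop :=
  exists f : {linear U -> V}, bijective f.

Section QuotMod.
Variables (k : fieldType) (V : lmodType k) (S : {pred V}).
Variable closedS : submod_closed S.

(* A copy of S, indexed by the closure proof so that instances can be
   attached to it. *)
Definition quot_pred of submod_closed S : V -> bool := fun x => x \in S.

Fact quotmod_zmod_closed : zmod_closed (quot_pred closedS).
Proof. exact: (GRing.submod_closedB closedS). Qed.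

HB.instance Definition _ :=
  GRing.isZmodClosed.Build V (quot_pred closedS) quotmod_zmod_closed.

Definition quot_submod : zmodClosed V :=
  GRing.ZmodClosed.clone V (quot_pred closedS) _.

Definition quotmod := Quotient.quot quot_submod.
HB.instance Definition _ := GRing.Zmodule.on quotmod.

Definition quotmod_pi (x : V) : quotmod := \pi_(Quotient.quot quot_submod) x.

Lemma quotmod_piE x y : (quotmod_pi x == quotmod_pi y) = (x - y \in S).
Proof. by rewrite -Quotient.idealrBE. Qed.

Definition quotmod_repr (q : quotmod) : V := repr (q : Quotient.quot quot_submod).

Lemma quotmod_reprK : cancel quotmod_repr quotmod_pi.
Proof. by move=> q; apply: reprK. Qed.

Lemma quotmod_pi_surj (q : quotmod) : exists x, q = quotmod_pi x.
Proof. by exists (quotmod_repr q); rewrite quotmod_reprK. Qed.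

Definition quotmod_scale (a : k) (q : quotmod) : quotmod :=
  quotmod_pi (a *: quotmod_repr q).

Fact quotmod_piD : {morph quotmod_pi : x y / x + y}.
Proof. by move=> x y; apply: (raddfD (\pi_(Quotient.quot quot_submod))). Qed.

Fact quotmod_scaleE a x : quotmod_scale a (quotmod_pi x) = quotmod_pi (a *: x).
Proof.
have [S0 lS] := closedS.
apply/eqP; rewrite quotmod_piE -scalerBr -[_ *: _]addr0; apply: lS => //.
by rewrite -quotmod_piE quotmod_reprK.
Qed.

Fact quotmod_scaleA a b q :
  quotmod_scale a (quotmod_scale b q) = quotmod_scale (a * b) q.
Proof.
by have [x ->] := quotmod_pi_surj q; rewrite !quotmod_scaleE scalerA.
Qed.

Fact quotmod_scale1 : left_id 1 quotmod_scale.
Proof.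
by move=> q; have [x ->] := quotmod_pi_surj q; rewrite quotmod_scaleE scale1r.
Qed.

Fact quotmod_scaleDr : right_distributive quotmod_scale +%R.
Proof.
move=> a q r; have [x ->] := quotmod_pi_surj q.
have [y ->] := quotmod_pi_surj r.
by rewrite -quotmod_piD !quotmod_scaleE -quotmod_piD scalerDr.
Qed.

Fact quotmod_scaleDl q : {morph quotmod_scale^~ q : a b / a + b}.
Proof.
move=> a b; have [x ->] := quotmod_pi_surj q.
by rewrite !quotmod_scaleE -quotmod_piD scalerDl.
Qed.

HB.instance Definition _ := GRing.Zmodule_isLmodule.Build k quotmod
  quotmod_scaleA quotmod_scale1 quotmod_scaleDr quotmod_scaleDl.

Fact quotmod_pi_linear : linear quotmod_pi.
Proof. by move=> a x y; rewrite quotmod_piD -quotmod_scaleE. Qed.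

HB.instance Definition _ := GRing.isLinear.Build k V quotmod _ quotmod_pi
  quotmod_pi_linear.

Lemma quotmod_pi_eq0 x : (quotmod_pi x == 0) = (x \in S).
Proof. by rewrite -(linear0 quotmod_pi) quotmod_piE subr0. Qed.
End QuotMod.

Section Span.
Variables (k : fieldType) (V : lmodType k) (X : V -> Prop).

Inductive spanned : V -> Prop :=
| Spanned0 : spanned 0
| SpannedD a x y : X x -> spanned y -> spanned (a *: x + y).

Definition lspan : {pred V} := fun x => `[< spanned x >].

Lemma lspan_submod_closed : submod_closed lspan.
Proof.
split; first by apply/asboolP; constructor.
move=> a x y /asboolP sx /asboolP sy; apply/asboolP.
elim: sx => [|b u v Xu _ IH]; first by rewrite scaler0 add0r.
by rewrite scalerDr scalerA -addrA; constructor.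
Qed.

Lemma sub_lspan x : X x -> x \in lspan.
Proof.
move=> Xx; apply/asboolP; rewrite -[x]scale1r -[1 *: x]addr0.
by constructor => //; constructor.
Qed.
End Span.

Section Dual.
Variables (k : fieldType) (V : lmodType k).

Definition linear_form : {pred V -> k^o} := fun f => `[< linear f >].

Fact linear_form_submod_closed : submod_closed linear_form.
Proof.
split; first by apply/asboolP => a x y; rewrite -[RHS]/(a *: 0 + 0) scaler0 addr0.
move=> a f g /asboolP lf /asboolP lg; apply/asboolP => b x y /=.
rewrite -[LHS]/(a *: f (b *: x + y) + g (b *: x + y)).
rewrite -[RHS]/(b *: (a *: f x + g x) + (a *: f y + g y)).
by rewrite lf lg !scalerDr !scalerA mulrC addrACA.
Qed.

HB.instance Definition _ := GRing.isSubmodClosed.Build k (V -> k^o) linear_form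
  linear_form_submod_closed.

Record dual := Dual { dual_fun :> V -> k^o; _ : dual_fun \in linear_form }.

HB.instance Definition _ := [isSub for dual_fun].
HB.instance Definition _ := [Choice of dual by <:].
HB.instance Definition _ := [SubChoice_isSubLmodule of dual by <:].

Fact dual_linear (f : dual) : linear f.
Proof. exact/asboolP/(valP f). Qed.

HB.instance Definition _ (f : dual) :=
  GRing.isLinear.Build k V k^o _ f (dual_linear f).

Lemma dualP (f g : dual) : f =1 g <-> f = g.
Proof. by split=> [fg|->//]; apply/val_inj/funext. Qed.

Lemma dualDE (f g : dual) x : (f + g) x = f x + g x.
Proof. by []. Qed.

Lemma dualZE a (f : dual) x : (a *: f) x = a * f x.
Proof. by []. Qed.
End Dual.

Section AlternatingMaps.
Variables (k : fieldType) (V W : lmodType k) (n : nat).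
Implicit Types a : {ffun 'I_n -> V}.

Definition upd (a : {ffun 'I_n -> V}) (i : 'I_n) (v : V) : {ffun 'I_n -> V} :=
  [ffun j => if j == i then v else a j].

Definition multilinear (f : {ffun 'I_n -> V} -> W) : Prop :=
  forall a i, linear (fun v => f (upd a i v)).

Definition alternating (f : {ffun 'I_n -> V} -> W) : Prop :=
  multilinear f /\ forall a i j, i != j -> a i = a j -> f a = 0.

Lemma updE a i v j : upd a i v j = if j == i then v else a j.
Proof. by rewrite ffunE. Qed.

Lemma upd_id a i : upd a i (a i) = a.
Proof. by apply/ffunP => j; rewrite updE; case: eqP => // ->. Qed.

Lemma upd_upd a i u v : upd (upd a i u) i v = upd a i v.
Proof. by apply/ffunP => j; rewrite !updE; case: eqP. Qed.

Lemma updC a i j u v : i != j -> upd (upd a i u) j v = upd (upd a j v) i u.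
Proof.
move=> ij; apply/ffunP => l; rewrite !updE.
by case: (eqVneq l j) => // ->; rewrite eq_sym (negPf ij).
Qed.

Lemma multilinearD f a i u v : multilinear f ->
  f (upd a i (u + v)) = f (upd a i u) + f (upd a i v).
Proof. by move=> mf; have := mf a i 1 u v; rewrite !scale1r. Qed.

Lemma multilinear0 f a i : multilinear f -> a i = 0 -> f a = 0.
Proof.
move=> mf ai0; have := mf a i 1 0 0.
rewrite !scale1r addr0 -{1 2 3}ai0 upd_id => /eqP.
by rewrite -subr_eq0 opprD addrA subrr add0r oppr_eq0 => /eqP.
Qed.

Lemma multilinear_adjacent f : multilinear f ->
  (forall a (i j : 'I_n), j = i.+1 :> nat -> a i = a j -> f a = 0) ->
  alternating f.
Proof.
move=> mf adj; split=> //.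
have swap a (i j : 'I_n) : j = i.+1 :> nat ->
    f (upd (upd a i (a j)) j (a i)) = - f a.
  move=> ij; have nij : i != j by rewrite -val_eqE /= ij neq_ltn leqnn.
  have h0 u : f (upd (upd a i u) j u) = 0.
    by apply: (adj _ i j ij); rewrite !updE !eqxx (negPf nij).
  have hDl u v w : f (upd (upd a i (u + v)) j w) =
      f (upd (upd a i u) j w) + f (upd (upd a i v) j w).
    by rewrite !(fun u => updC a u w nij) multilinearD.
  have := h0 (a i + a j).
  rewrite hDl !multilinearD // !h0 add0r addr0 upd_id upd_id => /eqP.
  by rewrite addrC addr_eq0 => /eqP.
have main d : forall a (i j : 'I_n), j = (i + d.+1)%N :> nat -> a i = a j -> f a = 0.
  elim: d => [|d IH] a i j; first by rewrite addn1; apply: adj.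
  move=> ij aij.
  have lt_j' : (i + d.+1 < n)%N by apply: ltn_trans (ltn_ord j); rewrite ij ltn_add2l.
  pose j' := Ordinal lt_j'.
  have jj' : j = j'.+1 :> nat by rewrite ij [LHS]addnS.
  have := swap a j' j jj'.
  rewrite (IH _ i j') //.
    by move/eqP; rewrite eq_sym oppr_eq0 => /eqP.
  have nij : i != j by rewrite -val_eqE /= ij neq_ltn addnS ltnS leq_addr.
  have nij' : i != j' by rewrite -val_eqE /= neq_ltn addnS ltnS leq_addr.
  have nj'j : j' != j by rewrite -val_eqE /= jj' neq_ltn leqnn.
  by rewrite !updE (negPf nij) (negPf nij') (negPf nj'j) eqxx.
move=> a i j; rewrite -val_eqE neq_ltn => /orP[] lt eqa.
  by apply: (main (j - i.+1)%N a i j) => //; rewrite addnS -addSn subnKC.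
by apply: (main (i - j.+1)%N a j i) => //; rewrite addnS -addSn subnKC.
Qed.
End AlternatingMaps.

Section ExteriorPower.
Variables (k : fieldType) (n : nat) (V : lmodType k).

Local Notation tuples := {ffun 'I_n -> V}.
Local Notation gen a := (<< a >> : {freeg tuples / k}).

(* ext_pow is the free module on the n-tuples of V modulo the submodule
   generated by these elements: multilinearity, and vanishing of the tuples
   with a repeated entry (which also gives the right notion when the
   characteristic is 2). *)
Inductive ext_relator : {freeg tuples / k} -> Prop :=
| ExtRelatorLinear (a : tuples) i c u v :
    ext_relator (gen (upd a i (c *: u + v))
                 - (c *: gen (upd a i u) + gen (upd a i v)))
| ExtRelatorAlt (a : tuples) i j :
    i != j -> a i = a j -> ext_relator (gen a).

Definition ext_pow := quotmod (lspan_submod_closed ext_relator).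
HB.instance Definition _ := GRing.Lmodule.on ext_pow.

Definition wedge (a : tuples) : ext_pow := quotmod_pi _ (gen a).

Lemma wedge_alternating : alternating wedge.
Proof.
split=> [a i c u v|a i j ij aij].
  rewrite /wedge -linearP; apply/eqP; rewrite quotmod_piE.
  exact/sub_lspan/ExtRelatorLinear.
by apply/eqP; rewrite quotmod_pi_eq0; apply/sub_lspan/(ExtRelatorAlt ij).
Qed.

Section Lift.
Variables (W : lmodType k) (f : tuples -> W).

Fact fglift_linear : linear (fglift f : {freeg tuples / k} -> W).
Proof.
have addf := lift_is_additive f.
have f0 : fglift f 0 = 0 by rewrite -[0 in LHS](subrr 0) addf subrr.
have fD x y : fglift f (x + y) = fglift f x + fglift f y.
  by rewrite -[y in LHS]opprK -[- y in LHS]sub0r !addf f0 sub0r opprK.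
have fS I (r : seq I) F : fglift f (\sum_(i <- r) F i) = \sum_(i <- r) fglift f (F i).
  by elim: r => [|i r IH]; rewrite ?big_nil ?big_cons // fD IH.
move=> c x y; rewrite fD; congr (_ + _).
have -> : fglift f x = \sum_(z <- dom x) coeff z x *: f z.
  by rewrite -[in LHS](freeg_sumE x) fS; apply: eq_bigr => z _; rewrite liftU.
rewrite -[c *: x]/(fgscale c x) fS scaler_sumr.
by apply: eq_bigr => z _; rewrite liftU scalerA.
Qed.

Definition ext_lift (q : ext_pow) : W :=
  fglift f (quotmod_repr q).

Variable altf : alternating f.

Fact ext_lift_pi x : ext_lift (quotmod_pi _ x) = fglift f x.
Proof.
set q := quotmod_pi _ x; apply/eqP; rewrite -subr_eq0; apply/eqP.
pose g : {linear {freeg tuples / k} -> W} := HB.pack (fglift f : _ -> _)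
  (GRing.isLinear.Build _ _ _ _ _ fglift_linear).
rewrite -[LHS]/(g (quotmod_repr q) - g x) -linearB.
have : quotmod_repr q - x \in lspan ext_relator.
  by rewrite -(quotmod_piE (lspan_submod_closed _)) quotmod_reprK.
move/asboolP; elim=> [|c u v Xu _ IH]; first by rewrite linear0.
rewrite linearP IH addr0; case: Xu => [a i d w z|a i j ij aij].
  rewrite linearB linearP /= !liftU !scale1r.
  by have [-> _] := altf; rewrite subrr scaler0.
by rewrite /= liftU scale1r; rewrite (altf.2 _ _ _ ij aij) scaler0.
Qed.

Lemma ext_lift_wedge a : ext_lift (wedge a) = f a.
Proof. by rewrite ext_lift_pi liftU scale1r. Qed.

Lemma ext_lift_linear : linear ext_lift.
Proof.
move=> c p q; have [x ->] := quotmod_pi_surj p.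
have [y ->] := quotmod_pi_surj q.
by rewrite -linearP !ext_lift_pi fglift_linear.
Qed.
End Lift.

Lemma ext_pow_eq (W : lmodType k) (f g : {linear ext_pow -> W}) :
  (forall a, f (wedge a) = g (wedge a)) -> f =1 g.
Proof.
move=> fg q; have [x ->] := quotmod_pi_surj q.
rewrite -(freeg_sumE x) !linear_sum; apply: eq_bigr => a _.
have -> : << coeff a x *g a >> = coeff a x *: gen a.
  by apply/eqP/freeg_eqP => b; rewrite coeffZ !coeffU mul1r.
by rewrite !linearZ /= fg.
Qed.

End ExteriorPower.

Notation cochain L n := (dual (ext_pow n L)).

HB.mixin Record Lmodule_isLie (k : fieldType) (L : Type) of GRing.Lmodule k L := {
  lie : L -> L -> L;
  lie_linearl : forall y, linear (fun x => lie x y);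
  lie_linearr : forall x, linear (lie x);
  liexx : forall x, lie x x = 0;
  lie_jacobi : forall x y z,
    lie x (lie y z) + lie y (lie z x) + lie z (lie x y) = 0
}.

#[short(type="lieAlgType")]
HB.structure Definition LieAlgebra (k : fieldType) :=
  {L of GRing.Lmodule k L & Lmodule_isLie k L}.

Section Differential.
Variables (k : fieldType) (L : lieAlgType k) (n : nat).

(* The tuple ([a_i, a_j], a_0, ..., a_n) in which a_i and a_j have been removed
   from the tail; it is only used for i < j, where the list has exactly n
   entries and the default value of nth is not reached. *)
Definition ce_args (a : {ffun 'I_n.+1 -> L}) (i j : 'I_n.+1) : {ffun 'I_n -> L} :=
  [ffun m : 'I_n =>
     nth 0 (lie (a i) (a j) ::
            [seq a l | l <- enum 'I_n.+1 & (l != i) && (l != j)]) m].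

Definition ce_sum (F : cochain L n) (a : {ffun 'I_n.+1 -> L}) : k^o :=
  \sum_(i < n.+1) \sum_(j < n.+1 | (i < j)%N)
    (-1) ^+ (i + j) * F (wedge (ce_args a i j)).

Let others (i j : 'I_n.+1) := [seq l <- enum 'I_n.+1 | (l != i) && (l != j)].

Let mem_others i j l : (l \in others i j) = (l != i) && (l != j).
Proof. by rewrite mem_filter mem_enum andbT. Qed.

Let size_others (i j : 'I_n.+1) : i != j -> size (others i j) = n.-1.
Proof.
move=> ij; have /card_uniqP <- : uniq (others i j).
  by rewrite filter_uniq ?enum_uniq.
rewrite (eq_card (mem_others i j)).
have -> : #|(fun l : 'I_n.+1 => (l != i) && (l != j))| = #|~: [set i; j]|.
  by apply: eq_card => l; rewrite !inE negb_or.
by rewrite cardsCs setCK cards2 ij card_ord subSS subn1.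
Qed.

Let n_gt0 (i j : 'I_n.+1) : i != j -> (0 < n)%N.
Proof. by move: i j; case: (n) => // i j; rewrite !ord1 eqxx. Qed.

Let index_others (i j s : 'I_n.+1) : i != j -> s \in others i j ->
  ((index s (others i j)).+1 < n)%N.
Proof.
by move=> ij; rewrite -index_mem size_others // -ltnS prednK // (n_gt0 ij).
Qed.

Let ce_args0 a i j (m : 'I_n) : m = 0%N :> nat -> ce_args a i j m = lie (a i) (a j).
Proof. by rewrite ffunE => ->. Qed.

Let ce_argsS a i j (m : 'I_n) d : i != j -> m = d.+1 :> nat ->
  ce_args a i j m = a (nth i (others i j) d).
Proof.
move=> ij md; rewrite ffunE md /= (nth_map i) // size_others //.
by rewrite -ltnS prednK ?(n_gt0 ij) // -md ltn_ord.
Qed.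

Let ce_args_index a i j s (m : 'I_n) : i != j -> s \in others i j ->
  m = (index s (others i j)).+1 :> nat -> ce_args a i j m = a s.
Proof. by move=> ij sO md; rewrite (ce_argsS _ ij md) nth_index. Qed.

Let ce_args_upd a (i j s : 'I_n.+1) : i != j ->
  exists m, exists2 phi : L -> L, linear phi &
    forall w, ce_args (upd a s w) i j = upd (ce_args a i j) m (phi w).
Proof.
move=> ij.
have n0 := n_gt0 ij; pose m0 := Ordinal n0.
have nths d : (d.+1 < n)%N -> nth i (others i j) d \in others i j.
  by move=> dn; rewrite mem_nth // size_others // -ltnS prednK.
have [si|nsi] := eqVneq s i; [|have [sj|nsj] := eqVneq s j].
- exists m0, (fun x => lie x (a j)); first exact: lie_linearl.
  move=> w; apply/ffunP => m; rewrite [RHS]updE; case: eqP => [->|/eqP].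
    by rewrite ce_args0 // !updE si eqxx eq_sym (negPf ij).
  rewrite -val_eqE /=; case md: (m : nat) => [//|d] _.
  have := nths d; rewrite -md ltn_ord mem_others => /(_ isT) /andP[di _].
  by rewrite !(ce_argsS _ ij md) updE si (negPf di).
- exists m0, (lie (a i)); first exact: lie_linearr.
  move=> w; apply/ffunP => m; rewrite [RHS]updE; case: eqP => [->|/eqP].
    by rewrite ce_args0 // !updE sj eqxx (negPf ij).
  rewrite -val_eqE /=; case md: (m : nat) => [//|d] _.
  have := nths d; rewrite -md ltn_ord mem_others => /(_ isT) /andP[_ dj].
  by rewrite !(ce_argsS _ ij md) updE sj (negPf dj).
have sO : s \in others i j by rewrite mem_others nsi nsj.
exists (Ordinal (index_others ij sO)), id => // w; apply/ffunP => m.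
rewrite [RHS]updE; case: eqP => [->|/eqP].
  by rewrite (ce_args_index _ ij sO) // updE eqxx.
rewrite -val_eqE /=; case md: (m : nat) => [|d].
  by rewrite !ce_args0 // !updE ![_ == s]eq_sym (negPf nsi) (negPf nsj).
move=> nd; rewrite !(ce_argsS _ ij md) updE; case: eqP => // ds.
case/eqP: nd; congr S; rewrite -ds index_uniq //.
  by rewrite size_others // -ltnS prednK // -md ltn_ord.
by rewrite filter_uniq ?enum_uniq.
Qed.

Let others_tperm (a : {ffun 'I_n.+1 -> L}) (s t : 'I_n.+1) (P : pred 'I_n.+1) :
  t = s.+1 :> nat -> a s = a t ->
  [seq a l | l <- enum 'I_n.+1 & P (tperm s t l)] =
  [seq a l | l <- enum 'I_n.+1 & P l].
Proof.
move=> st ast; pose e := enum 'I_n.+1.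
have nth_e (m : 'I_n.+1) : nth s e m = m by rewrite nth_ord_enum.
have e_eq : e = take s e ++ s :: t :: drop t.+1 e.
  rewrite -[LHS](cat_take_drop s); congr (_ ++ _).
  rewrite (drop_nth s) ?size_enum_ord // nth_e -st (drop_nth s) ?size_enum_ord //.
  by rewrite nth_e.
have : uniq ([:: s; t] ++ take s e ++ drop t.+1 e).
  by rewrite uniq_catCA /= -e_eq enum_uniq.
rewrite /= inE negb_or => /and3P[/andP[_ sN] tN _].
have fix_ l : l \in take s e ++ drop t.+1 e -> tperm s t l = l.
  by move=> le; apply: tpermD; apply: contraTneq le => <-.
rewrite -/e e_eq !filter_cat !map_cat /= tpermL tpermR.
congr (_ ++ _).
  by congr map; apply: eq_in_filter => l le; rewrite fix_ // mem_cat le.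
have -> : [seq l <- drop t.+1 e | P (tperm s t l)] = [seq l <- drop t.+1 e | P l].
  by apply: eq_in_filter => l le; rewrite fix_ // mem_cat le orbT.
by case: (P s); case: (P t) => /=; rewrite ?ast.
Qed.

Lemma ce_sum_alternating (F : cochain L n) : alternating (ce_sum F).
Proof.
pose f := fun b => F (wedge b).
have [mf altf] : alternating f.
  have [mw aw] := wedge_alternating n L.
  split=> [a i c u v|a i j ij aij]; first by rewrite /f mw linearP.
  by rewrite /f (aw _ _ _ ij aij) linear0.
apply: multilinear_adjacent => [a s c u v|a s t st ast].
  rewrite /ce_sum scaler_sumr -big_split /=; apply: eq_bigr => i _.
  rewrite scaler_sumr -big_split /=; apply: eq_bigr => j ij.
  have nij : i != j by rewrite -val_eqE neq_ltn ij.
  have [m [phi lphi upd_phi]] := ce_args_upd a s nij.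
  rewrite !upd_phi lphi -![F _]/(f _) mf mulrDr.
  by congr (_ + _); rewrite /GRing.scale /= mulrCA.
pose T (p : 'I_n.+1 * 'I_n.+1) : k^o :=
  (-1) ^+ (p.1 + p.2) * F (wedge (ce_args a p.1 p.2)).
rewrite /ce_sum (pair_big_dep xpredT (fun i j : 'I_n.+1 => (i < j)%N) (fun i j => T (i, j))) /=.
pose q (x : 'I_n.+1) (p : 'I_n.+1 * 'I_n.+1) := (x == p.1) || (x == p.2).
have nst : s != t by rewrite -val_eqE /= st neq_ltn leqnn.
have atp l : a (tperm s t l) = a l by case: tpermP => // ->.
rewrite (bigID (q s)) /= [X in X + _](bigID (q t)) /= [X in _ + X](bigID (q t)) /=.
rewrite [X in X + _ + _]big1 => [|p /andP[/andP[lt12 qs] qt]]; last first.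
  have np : p.1 != p.2 by rewrite -val_eqE neq_ltn lt12.
  suff lie0 : lie (a p.1) (a p.2) = 0.
    rewrite /T -/(f _) (@multilinear0 _ _ _ _ _ _ (Ordinal (n_gt0 np)) mf) ?mulr0 //.
    by rewrite ce_args0.
  case/orP: qs => /eqP es; case/orP: qt => /eqP et.
  - by move: nst; rewrite es et eqxx.
  - by rewrite -es -et ast liexx.
  - by rewrite -es -et ast liexx.
  - by move: nst; rewrite es et eqxx.
rewrite [X in _ + (_ + X)]big1 => [|p /andP[/andP[lt12 qs] qt]]; last first.
  have np : p.1 != p.2 by rewrite -val_eqE neq_ltn lt12.
  have sO : s \in others p.1 p.2 by rewrite mem_others -negb_or.
  have tO : t \in others p.1 p.2 by rewrite mem_others -negb_or.
  rewrite /T -/(f _) (altf _ (Ordinal (index_others np sO))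
    (Ordinal (index_others np tO))) ?mulr0 //.
    by rewrite -val_eqE /= eqSS; apply: contra_neq nst => /index_inj ->.
  by rewrite (ce_args_index _ np sO) // (ce_args_index _ np tO).
rewrite add0r addr0.
pose h (p : 'I_n.+1 * 'I_n.+1) := (tperm s t p.1, tperm s t p.2).
have hK : involutive h by case=> x y; rewrite /h /= !tpermK.
rewrite [X in _ + X](reindex_inj (inv_inj hK)) /=.
have qh x p : q (tperm s t x) (h p) = q x p.
  by rewrite /q /h /= !(inj_eq perm_inj).
have tperm_val (z : 'I_n.+1) : z != t -> tperm s t z = (z + (z == s))%N :> nat.
  move=> zt; have [->|zs] := eqVneq z s; first by rewrite tpermL st addn1.
  by rewrite tpermD ?addn0 // eq_sym.
have lt_h p : ~~ q t p -> (tperm s t p.1 < tperm s t p.2)%N = (p.1 < p.2)%N.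
  rewrite negb_or ![t == _]eq_sym => /andP[t1 t2]; rewrite !tperm_val //.
  have [->|ns1] := eqVneq p.1 s; have [->|ns2] := eqVneq p.2 s.
  - by rewrite !ltnn.
  - rewrite addn1 addn0 [RHS]leq_eqVlt -st.
    by move: t2; rewrite -val_eqE /= eq_sym => /negPf ->.
  - rewrite addn1 addn0 ltnS leq_eqVlt.
    by move: ns1; rewrite -val_eqE /= => /negPf ->.
  - by rewrite !addn0.
rewrite [X in _ + X](eq_bigl (fun p : 'I_n.+1 * 'I_n.+1 => (p.1 < p.2)%N && q s p && ~~ q t p)); last first.
  move=> p; have := qh t p; have := qh s p; rewrite tpermL tpermR /= => -> ->.
  rewrite -!andbA [~~ _ && _]andbC; have [_|nqt] := boolP (q t p).
    by rewrite !andbF.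
  by rewrite lt_h.
rewrite -big_split big1 //= => p /andP[/andP[lt12 qs] qt].
have np : p.1 != p.2 by rewrite -val_eqE neq_ltn lt12.
rewrite /T /=.
have -> : ce_args a (tperm s t p.1) (tperm s t p.2) = ce_args a p.1 p.2.
  apply/ffunP => m; rewrite !ffunE !atp.
  rewrite -(others_tperm (fun l => (l != p.1) && (l != p.2)) st ast).
  congr (nth 0 (_ :: map a _) _); apply: eq_filter => l.
  by rewrite -![tperm s t l == _](inj_eq (@perm_inj _ (tperm s t))) tpermK.
rewrite -mulrDl.
suff -> : ((-1) ^+ (tperm s t p.1 + tperm s t p.2) : k) = - (-1) ^+ (p.1 + p.2).
  by rewrite addrN mul0r.
move: qt; rewrite negb_or ![t == _]eq_sym => /andP[t1 t2].
rewrite !tperm_val // addnACA.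
have -> : ((p.1 == s) + (p.2 == s) = 1)%N.
  by case/orP: qs => /eqP ->; rewrite eqxx ?(negPf np) // eq_sym (negPf np).
by rewrite addn1 exprS mulN1r.
Qed.

Definition ce_diff (F : cochain L n) : cochain L n.+1 :=
  Dual (introT (asboolP _) (ext_lift_linear (ce_sum_alternating F))).

Lemma ce_diffE F a : ce_diff F (wedge a) = ce_sum F a.
Proof. exact/ext_lift_wedge/ce_sum_alternating. Qed.

Lemma ce_diff_linear : linear ce_diff.
Proof.
move=> c F G; apply/dualP; apply: ext_pow_eq => a.
rewrite -[LHS]/(ce_diff (c *: F + G) (wedge a)).
rewrite -[RHS]/(c * ce_diff F (wedge a) + ce_diff G (wedge a)) !ce_diffE /ce_sum mulr_sumr -big_split /=.
apply: eq_bigr => i _; rewrite mulr_sumr -big_split /=; apply: eq_bigr => j _.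
by rewrite mulrDr mulrCA.
Qed.

HB.instance Definition _ := GRing.isLinear.Build k (cochain L n)
  (cochain L n.+1) _ ce_diff ce_diff_linear.
End Differential.

Section Cohomology.
Variables (k : fieldType) (L : lieAlgType k).

Definition is_cocycle n : {pred (cochain L n)} := fun F => ce_diff F == 0.

Fact is_cocycle_submod_closed n : submod_closed (@is_cocycle n).
Proof.
split=> [|c F G /eqP dF /eqP dG]; apply/eqP; first exact: linear0.
by rewrite linearP /= dF dG scaler0 addr0.
Qed.

HB.instance Definition _ n := GRing.isSubmodClosed.Build k (cochain L n)
  (@is_cocycle n) (is_cocycle_submod_closed n).

Record cocycle n := Cocycle {
  cocycle_val :> cochain L n;
  _ : cocycle_val \in @is_cocycle n
}.

HB.instance Definition _ n := [isSub for @cocycle_val n].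
HB.instance Definition _ n := [Choice of cocycle n by <:].
HB.instance Definition _ n := [SubChoice_isSubLmodule of cocycle n by <:].

(* C^(-1) = 0, so that only 0 is a coboundary in degree 0. This is a predicate
   on cocycles, hence the quotient below does not need ce_diff \o ce_diff = 0. *)
Definition is_coboundary n : {pred cocycle n} :=
  match n with
  | 0 => fun z => z == 0
  | m.+1 => fun z => `[< exists F : cochain L m, ce_diff F = z :> cochain L m.+1 >]
  end.

Fact is_coboundary_submod_closed n : submod_closed (@is_coboundary n).
Proof.
case: n => [|n]; split=> /=.
- exact/eqP.
- by move=> c x y /eqP -> /eqP ->; apply/eqP; rewrite scaler0 addr0.
- by apply/asboolP; exists 0; rewrite linear0.
move=> c x y /asboolP[F dF] /asboolP[G dG]; apply/asboolP.
by exists (c *: F + G); rewrite linearP /= dF dG.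
Qed.

Definition lie_cohomology n := quotmod (@is_coboundary_submod_closed n).
HB.instance Definition _ n := GRing.Lmodule.on (lie_cohomology n).
End Cohomology.

Section MatrixLie.
Variables (k : fieldType) (N : nat).

Definition mx_lie (A B : 'M[k]_N) : 'M[k]_N := A *m B - B *m A.

Fact mx_lie_linearl B : linear (mx_lie^~ B).
Proof.
move=> c A A'; rewrite /mx_lie mulmxDl mulmxDr -scalemxAl -scalemxAr.
by rewrite opprD addrACA scalerBr.
Qed.

Fact mx_lie_linearr A : linear (mx_lie A).
Proof.
move=> c B B'; rewrite /mx_lie mulmxDl mulmxDr -scalemxAl -scalemxAr.
by rewrite opprD addrACA scalerBr.
Qed.

Fact mx_liexx A : mx_lie A A = 0.
Proof. exact: subrr. Qed.

Fact mx_lie_jacobi A B C :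
  mx_lie A (mx_lie B C) + mx_lie B (mx_lie C A) + mx_lie C (mx_lie A B) = 0.
Proof.
rewrite /mx_lie !mulmxBl !mulmxBr !mulmxA !opprB !addrA.
rewrite [LHS](ACl ((1*12)*(2*7)*(3*10)*(4*5)*(6*11)*(8*9)))%AC /=.
by rewrite !subrr !addNr !addr0.
Qed.

HB.instance Definition _ := Lmodule_isLie.Build k 'M[k]_N
  mx_lie_linearl mx_lie_linearr mx_liexx mx_lie_jacobi.

Definition sl_mx : {pred 'M[k]_N} := fun A => \tr A == 0.

(* is_trig_mx means lower triangular, hence the transpose *)
Definition borel_mx : {pred 'M[k]_N} := fun A => (A \in sl_mx) && is_trig_mx A^T.

Definition cartan_mx : {pred 'M[k]_N} := fun A => (A \in sl_mx) && is_diag_mx A.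

Fact borel_mx_submod_closed : submod_closed borel_mx.
Proof.
split=> [|c A B].
  by rewrite /borel_mx unfold_in /sl_mx unfold_in mxtrace0 eqxx trmx0 mx0_is_trig.
case/andP=> /eqP tA /is_trig_mxP uA /andP[/eqP tB /is_trig_mxP uB].
apply/andP; split; first by apply/eqP; rewrite mxtraceD mxtraceZ tA tB mulr0 addr0.
apply/is_trig_mxP => i j ij; have := uA i j ij; have := uB i j ij.
by rewrite !mxE => -> ->; rewrite mulr0 addr0.
Qed.

Fact cartan_mx_submod_closed : submod_closed cartan_mx.
Proof.
split=> [|c A B].
  by rewrite /cartan_mx unfold_in /sl_mx unfold_in mxtrace0 eqxx mx0_is_diag.
case/andP=> /eqP tA /is_diag_mxP uA /andP[/eqP tB /is_diag_mxP uB].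
apply/andP; split; first by apply/eqP; rewrite mxtraceD mxtraceZ tA tB mulr0 addr0.
apply/is_diag_mxP => i j ij.
by rewrite !mxE uA // uB // mulr0 addr0.
Qed.

HB.instance Definition _ := GRing.isSubmodClosed.Build k 'M[k]_N borel_mx
  borel_mx_submod_closed.
HB.instance Definition _ := GRing.isSubmodClosed.Build k 'M[k]_N cartan_mx
  cartan_mx_submod_closed.

Record borel := Borel { borel_val :> 'M[k]_N; _ : borel_val \in borel_mx }.
HB.instance Definition _ := [isSub for borel_val].
HB.instance Definition _ := [Choice of borel by <:].
HB.instance Definition _ := [SubChoice_isSubLmodule of borel by <:].

Record cartan := Cartan { cartan_val :> 'M[k]_N; _ : cartan_val \in cartan_mx }.
HB.instance Definition _ := [isSub for cartan_val].
HB.instance Definition _ := [Choice of cartan by <:].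
HB.instance Definition _ := [SubChoice_isSubLmodule of cartan by <:].

Fact borel_mx_lie (A B : borel) : lie (A : 'M[k]_N) (B : 'M[k]_N) \in borel_mx.
Proof.
apply/andP; split.
  by apply/eqP; rewrite raddfB /= mxtrace_mulC subrr.
have uM (X Y : borel) : is_trig_mx ((X : 'M[k]_N) *m (Y : 'M[k]_N))^T.
  case: X Y => [X /= /andP[_ /is_trig_mxP uX]] [Y /= /andP[_ /is_trig_mxP uY]].
  apply/is_trig_mxP => i j ij; rewrite !mxE big1 // => l _.
  have [li|il] := ltnP l j.
    by have := uX l j li; rewrite mxE => ->; rewrite mul0r.
  by have := uY i l (leq_trans ij il); rewrite mxE => ->; rewrite mulr0.
apply/is_trig_mxP => i j ij.
have /is_trig_mxP/(_ i j ij) := uM A B; have /is_trig_mxP/(_ i j ij) := uM B A.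
by rewrite !mxE => -> ->; rewrite subr0.
Qed.

Definition borel_lie (A B : borel) : borel := Borel (borel_mx_lie A B).

Fact borel_lie_linearl B : linear (borel_lie^~ B).
Proof. by move=> c A A'; apply: val_inj; apply: lie_linearl. Qed.

Fact borel_lie_linearr A : linear (borel_lie A).
Proof. by move=> c B B'; apply: val_inj; apply: lie_linearr. Qed.

Fact borel_liexx A : borel_lie A A = 0.
Proof. by apply: val_inj; apply: liexx. Qed.

Fact borel_lie_jacobi A B C : borel_lie A (borel_lie B C) +
  borel_lie B (borel_lie C A) + borel_lie C (borel_lie A B) = 0.
Proof. by apply: val_inj; apply: lie_jacobi. Qed.

HB.instance Definition _ := Lmodule_isLie.Build k borel
  borel_lie_linearl borel_lie_linearr borel_liexx borel_lie_jacobi.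
End MatrixLie.

(* Main.v *)
From HB Require Import structures.
Require Import Defs.
From mathcomp Require Import all_boot all_order all_algebra.
From mathcomp Require Import boolp.

Set Implicit Arguments.
Unset Strict Implicit.
Unset Printing Implicit Defensive.

Import GRing.Theory.
Local Open Scope ring_scope.

(* The off-diagonal entries are removed one row at a time. The element
   x = E_rr - 1/N of b acts on the matrices whose rows above r are diagonal with
   eigenvalue 1 on the off-diagonal part of row r and 0 elsewhere; scaling that
   part by t, after erasing the off-diagonal part of the rows above r, gives Lie
   endomorphisms phi_t of b. For a cocycle F one has phi_t^* F = sum_m t^m F_m,
   where F_m = 0 for m > N because F alternates. By Cartan's formula the
   coboundary of i_x (phi_t^* F) is - sum_m m t^m F_m. Since 1, ..., N are
   distinct and nonzero in k, there are weights c_s with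
   sum_(1 <= s <= N) c_s s^m = 1/m for 1 <= m <= N, and the corresponding
   combination of contractions has coboundary phi_0^* F - phi_1^* F. After all
   rows, F is cohomologous to its pullback along the projection of b onto h, so
   restriction to h and inflation from h are mutually inverse on cohomology; the
   differential vanishes on h. *)

(** * Multilinear and alternating maps on tuples *)

Section Alternating.
Variables (k : fieldType) (V W : lmodType k).

(** Induction on the number [d] of leading entries not yet known to lie in [X]: expanding entry [d]
    of a tuple over the spanning set reduces [d.+1] to [d]. *)
Lemma multilinear_spanned n (f : {ffun 'I_n -> V} -> W) (X : V -> Prop) :
  multilinear f -> (forall v, spanned X v) ->
  (forall a : {ffun 'I_n -> V}, (forall i, X (a i)) -> f a = 0) -> forall a, f a = 0.
Proof.
move=> mf spanX fX a.
suff main d : forall b : {ffun 'I_n -> V},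
    (forall i : 'I_n, (d <= i)%N -> X (b i)) -> f b = 0.
  by apply: (main n) => i; rewrite leqNgt ltn_ord.
elim: d => [|d IH] b Xb; first by apply: fX => i; apply: Xb.
have [ltdn|lend] := ltnP d n; last first.
  by apply: IH => i; rewrite leqNgt (leq_trans (ltn_ord i)).
pose i0 := Ordinal ltdn; rewrite -(upd_id b i0).
elim: (spanX (b i0)) => [|c x y Xx _ fy].
  by apply: (multilinear0 (i := i0)); rewrite // updE eqxx.
rewrite mf fy addr0 IH ?scaler0 // => i ledi; rewrite updE.
case: eqP => // /eqP; rewrite -val_eqE /= => nid.
by apply: Xb; rewrite ltn_neqAle eq_sym nid.
Qed.

Lemma multilinear_scale n (f : {ffun 'I_n -> V} -> W) (c : 'I_n -> k)
    (a : {ffun 'I_n -> V}) :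
  multilinear f -> f [ffun i => c i *: a i] = (\prod_i c i) *: f a.
Proof.
move=> mf; suff main d :
    f [ffun i : 'I_n => if (i < d)%N then c i *: a i else a i] =
    (\prod_(i < n | (i < d)%N) c i) *: f a.
  have -> : \prod_i c i = \prod_(i < n | (i < n)%N) c i.
    by apply: eq_bigl => i; rewrite ltn_ord.
  by rewrite -main; congr f; apply/ffunP => i; rewrite !ffunE ltn_ord.
elim: d => [|d IH].
  by rewrite big_pred0 // scale1r; congr f; apply/ffunP => i; rewrite ffunE.
have [ltdn|lend] := ltnP d n; last first.
  have ltE (i : 'I_n) : (i < d.+1)%N = (i < d)%N.
    by rewrite ltnS ltnW (leq_trans (ltn_ord i)).
  rewrite (eq_bigl _ _ ltE) -IH; congr f.
  by apply/ffunP => i; rewrite !ffunE ltE.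
pose i0 := Ordinal ltdn.
have ltE (i : 'I_n) : (i < d)%N = (i < d.+1)%N && (i != i0).
  by rewrite -val_eqE /= ltnS andbC -ltn_neqAle.
rewrite (bigD1 i0) //= -(eq_bigl _ _ ltE) -scalerA -IH.
set b := (X in _ = _ *: f X).
(* The summand 0 brings the scaled entry into the form required by [multilinear]; its own term then
   vanishes. *)
transitivity (f (upd b i0 (c i0 *: a i0 + 0))).
  rewrite addr0; congr f; apply/ffunP => i; rewrite updE !ffunE.
  case: eqP => [->|/eqP ni]; first by rewrite ltnSn.
  by rewrite ltE ni andbT.
rewrite mf [X in _ + X](multilinear0 (i := i0)) ?updE ?eqxx // addr0.
congr (_ *: f _); rewrite -[RHS](upd_id _ i0); congr upd.
by rewrite ffunE ltnn.
Qed.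

(** Substitute the vanishing combination for the entry [h q]: every term except the one of index [q]
    repeats an entry, so [c q *: f a = 0] remains. *)
Lemma alternating_dependent n m (f : {ffun 'I_n -> V} -> W) (a : {ffun 'I_n -> V})
    (h : 'I_m -> 'I_n) (c : 'I_m -> k) q :
  alternating f -> injective h -> \sum_p c p *: a (h p) = 0 -> c q != 0 ->
  f a = 0.
Proof.
move=> [mf altf] inj_h dep cq.
pose g0 : {linear V -> W} := HB.pack (fun v => f (upd a (h q) v))
  (GRing.isLinear.Build _ _ _ _ _ (mf a (h q))).
have [g gE] : exists g : {linear V -> W}, forall v, g v = f (upd a (h q) v).
  by exists g0.
have : g (\sum_p c p *: a (h p)) = 0 by rewrite dep linear0.
rewrite linear_sum (bigD1 q) //= big1 => [|p npq]; last first.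
  rewrite linearZ /= gE (altf _ (h p) (h q)) ?scaler0 ?(inj_eq inj_h) //.
  by rewrite !updE (inj_eq inj_h) (negPf npq) eqxx.
rewrite addr0 linearZ /= gE upd_id => /eqP.
by rewrite scaler_eq0 (negPf cq) => /eqP.
Qed.

(** More than [M] row vectors of length [M] are linearly dependent, and injectivity of [rho] on the
    span of the selected entries lifts the relation to these entries. *)
Lemma alternating_rank n (f : {ffun 'I_n -> V} -> W) (a : {ffun 'I_n -> V})
    (S : {set 'I_n}) M (rho : {linear V -> 'rV[k]_M}) :
  alternating f -> (M < #|S|)%N ->
  (forall c : 'I_n -> k, rho (\sum_(i in S) c i *: a i) = 0 ->
     \sum_(i in S) c i *: a i = 0) ->
  f a = 0.
Proof.
move=> altf ltMS inj_rho.
pose A : 'M_(#|S|, M) := \matrix_p rho (a (enum_val p)).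
have : kermx A != 0.
  rewrite -mxrank_eq0 mxrank_ker subn_eq0 -ltnNge.
  exact: leq_ltn_trans (rank_leq_col A) ltMS.
case/rowV0Pn=> u /sub_kermxP uA0 /rV0Pn[q uq].
apply: (alternating_dependent (h := @enum_val _ _) (c := u 0) altf _ _ uq).
  exact: enum_val_inj.
(* The coefficients, indexed by positions in the enumeration of [S], are extended by zero to all of
   ['I_n]. *)
pose c i := if [pick p | enum_val p == i] is Some p then u 0 p else 0.
have cE p : c (enum_val p) = u 0 p.
  rewrite /c; case: pickP => [p' /eqP/enum_val_inj -> //|/(_ p)].
  by rewrite eqxx.
have sumE : \sum_p u 0 p *: a (enum_val p) = \sum_(i in S) c i *: a i.
  by rewrite [RHS]big_enum_val; apply: eq_bigr => p _; rewrite cE.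
rewrite sumE inj_rho // -sumE linear_sum -[RHS]uA0 mulmx_sum_row.
by apply: eq_bigr => p _; rewrite linearZ rowK.
Qed.

(** With tuples written as lists, moving or deleting an entry is a matter of concatenation. A short
    list is padded with 0 and a long one is truncated. *)
Definition ffun_seq n (s : seq V) : {ffun 'I_n -> V} :=
  [ffun i : 'I_n => nth 0 s i].

(** Polarization: with [u + v] in both slots the value is 0, and its expansion leaves only the two
    mixed terms. *)
Lemma alternating_swap n (f : {ffun 'I_n -> V} -> W) s1 u v s2 :
  alternating f -> ((size s1).+1 < n)%N ->
  f (ffun_seq n (s1 ++ u :: v :: s2)) = - f (ffun_seq n (s1 ++ v :: u :: s2)).
Proof.
move=> [mf altf] lt2; pose i := Ordinal (ltnW lt2); pose j := Ordinal lt2.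
have nij : i != j by rewrite -val_eqE /= neq_ltn ltnSn.
pose a := ffun_seq n (s1 ++ 0 :: 0 :: s2).
have aE x y : ffun_seq n (s1 ++ x :: y :: s2) = upd (upd a i x) j y.
  apply/ffunP => l; rewrite !updE !ffunE !nth_cat -!val_eqE /=.
  case: ltnP => [lt|]; first by rewrite !ltn_eqF // ltnW.
  rewrite leq_eqVlt => /orP[/eqP <-|]; first by rewrite subnn eqxx ltn_eqF.
  rewrite leq_eqVlt => /orP[/eqP <-|lt]; first by rewrite subSnn eqxx.
  by rewrite -(subnSK (ltnW lt)) -(subnSK lt) !gtn_eqF // ltnW.
have h0 x : f (upd (upd a i x) j x) = 0.
  by apply: (altf _ i j nij); rewrite !updE eqxx (negPf nij) eqxx.
have := h0 (u + v); rewrite multilinearD // ![upd (upd a i (u + v)) _ _]updC //.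
rewrite !multilinearD // -![upd (upd a j _) _ _]updC // !h0 add0r addr0 !aE.
by move=> /eqP; rewrite addr_eq0 => /eqP ->; rewrite opprK.
Qed.

Lemma alternating_move n (f : {ffun 'I_n -> V} -> W) s1 u s2 :
  alternating f -> (size s1 < n)%N ->
  f (ffun_seq n (u :: s1 ++ s2)) =
  (-1) ^+ size s1 *: f (ffun_seq n (s1 ++ u :: s2)).
Proof.
(* The prefix [s0] collects the entries that [u] has already passed. *)
move=> altf; suff main s0 : (size s0 + size s1 < n)%N ->
    f (ffun_seq n (s0 ++ u :: s1 ++ s2)) =
    (-1) ^+ size s1 *: f (ffun_seq n (s0 ++ s1 ++ u :: s2)).
  exact: (main [::]).
elim: s1 s0 => [|x s1 IH] s0 /= lt_n; first by rewrite scale1r.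
rewrite alternating_swap //; last first.
  by apply: leq_ltn_trans lt_n; rewrite addnS ltnS leq_addr.
rewrite -cat_rcons IH ?size_rcons ?addSnnS // cat_rcons.
by rewrite exprS mulN1r scaleNr.
Qed.
End Alternating.

(** * Deleting and replacing entries of tuples written as lists *)

Lemma filter_enum_ord n (P : pred 'I_n.+1) :
  [seq l <- enum 'I_n.+1 | P l] =
  (if P ord0 then cons ord0 else id)
    [seq lift ord0 l | l <- enum 'I_n & P (lift ord0 l)].
Proof. by rewrite enum_ordSl /= filter_map; case: (P ord0). Qed.

(** Together with [filter_seq], this puts the tuple with [v] in slot [j] and the tuple with [v] in
    front and [a j] deleted into the shapes compared by [alternating_move]. *)
Lemma upd_seq (k : fieldType) (V : lmodType k) n (a : {ffun 'I_n -> V}) j v :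
  upd a j v =
  ffun_seq n (take j [seq a l | l <- enum 'I_n] ++
              v :: drop j.+1 [seq a l | l <- enum 'I_n]).
Proof.
have sz : size [seq a l | l <- enum 'I_n] = n by rewrite size_map size_enum_ord.
apply/ffunP => i; rewrite updE ffunE nth_cat size_take sz ltn_ord -val_eqE /=.
have aE : nth 0 [seq a l | l <- enum 'I_n] i = a i.
  by rewrite (nth_map i) ?size_enum_ord // nth_ord_enum.
case: ltngtP => [lt|lt|->]; last by rewrite subnn.
  by rewrite nth_take.
by rewrite -(subnSK lt) /= nth_drop subnKC.
Qed.

Lemma filter_seq n (T : Type) (a : 'I_n -> T) (j : 'I_n) :
  [seq a l | l <- enum 'I_n & l != j] =
  take j [seq a l | l <- enum 'I_n] ++ drop j.+1 [seq a l | l <- enum 'I_n].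
Proof.
rewrite -map_take -map_drop -map_cat; congr map.
have e_eq : enum 'I_n = take j (enum 'I_n) ++ j :: drop j.+1 (enum 'I_n).
  rewrite -{1}(cat_take_drop j (enum 'I_n)) (drop_nth j) ?size_enum_ord //.
  by rewrite nth_ord_enum.
have : uniq (j :: take j (enum 'I_n) ++ drop j.+1 (enum 'I_n)).
  by rewrite -cat1s uniq_catCA /= -e_eq enum_uniq.
rewrite cons_uniq mem_cat negb_or => /andP[/andP[jt jd] _].
rewrite {1}e_eq filter_cat /= eqxx; congr (_ ++ _); apply/all_filterP/allP.
  by move=> l lt; apply: contraNneq jt => lj; rewrite -{1}lj.
by move=> l ld; apply: contraNneq jd => lj; rewrite -{1}lj.
Qed.

(** * Pullback and contraction of cochains, and Cartan's formula *)

Section Cochains.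
Variables (k : fieldType).
Implicit Types U V W : lmodType k.

Definition dual_of_alternating n V (f : {ffun 'I_n -> V} -> k^o)
    (altf : alternating f) : dual (ext_pow n V) :=
  Dual (introT (asboolP _) (ext_lift_linear altf)).

Lemma dual_of_alternatingE n V (f : {ffun 'I_n -> V} -> k^o)
    (altf : alternating f) a :
  dual_of_alternating altf (wedge a) = f a.
Proof. exact: ext_lift_wedge. Qed.

Lemma dual_wedge_eq n V (F G : dual (ext_pow n V)) :
  (forall a, F (wedge a) = G (wedge a)) -> F = G.
Proof. by move=> FG; apply/dualP; apply: ext_pow_eq. Qed.

Lemma dualBE V (F G : dual V) x : (F - G) x = F x - G x.
Proof. by []. Qed.

Lemma dual_sumE V (I : Type) (r : seq I) (F : I -> dual V) x :
  (\sum_(i <- r) F i) x = \sum_(i <- r) F i x.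
Proof. exact: (big_morph (fun f : dual V => f x)). Qed.

Lemma dual_wedge_alternating n V (F : dual (ext_pow n V)) :
  alternating (fun a => F (wedge a)).
Proof.
have [mw aw] := wedge_alternating n V.
split=> [a i c u v|a i j ij aij]; first by rewrite mw linearP.
by rewrite (aw _ _ _ ij aij) linear0.
Qed.

Section Pullback.
Variables (n : nat) (U V : lmodType k) (phi : {linear U -> V}).
Variable F : dual (ext_pow n V).

Definition ffun_comp (a : {ffun 'I_n -> U}) : {ffun 'I_n -> V} :=
  [ffun i => phi (a i)].

Fact pullback_alternating : alternating (fun a => F (wedge (ffun_comp a))).
Proof.
have [mf af] := dual_wedge_alternating F.
have compE a i v : ffun_comp (upd a i v) = upd (ffun_comp a) i (phi v).
  by apply/ffunP => j; rewrite !ffunE; case: eqP.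
split=> [a i c u v|a i j ij aij]; first by rewrite !compE linearP mf.
by apply: (af _ i j ij); rewrite !ffunE aij.
Qed.

Definition pullback : dual (ext_pow n U) :=
  dual_of_alternating pullback_alternating.

Lemma pullbackE a : pullback (wedge a) = F (wedge (ffun_comp a)).
Proof. exact: dual_of_alternatingE. Qed.
End Pullback.

Lemma pullback_linear n U V (phi : {linear U -> V}) :
  linear (fun F : dual (ext_pow n V) => pullback phi F).
Proof.
move=> c F G; apply: dual_wedge_eq => a.
by rewrite dualDE dualZE !pullbackE dualDE dualZE.
Qed.

HB.instance Definition _ n U V (phi : {linear U -> V}) :=
  GRing.isLinear.Build k (dual (ext_pow n V)) (dual (ext_pow n U)) _
    (@pullback n U V phi) (@pullback_linear n U V phi).

Lemma pullback_comp n U V W (phi : {linear U -> V}) (psi : {linear V -> W})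
    (chi : {linear U -> W}) (F : dual (ext_pow n W)) :
  (forall u, psi (phi u) = chi u) ->
  pullback phi (pullback psi F) = pullback chi F.
Proof.
move=> comp; apply: dual_wedge_eq => a; rewrite !pullbackE.
by congr (F (wedge _)); apply/ffunP => i; rewrite !ffunE comp.
Qed.

Lemma eq_pullback n U V (phi psi : {linear U -> V}) (F : dual (ext_pow n V)) :
  phi =1 psi -> pullback phi F = pullback psi F.
Proof.
move=> eq_phi; apply: dual_wedge_eq => a; rewrite !pullbackE.
by congr (F (wedge _)); apply/ffunP => i; rewrite !ffunE eq_phi.
Qed.

Lemma pullback_id n V (phi : {linear V -> V}) (F : dual (ext_pow n V)) :
  phi =1 id -> pullback phi F = F.
Proof.
move=> phi1; apply: dual_wedge_eq => a; rewrite !pullbackE.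
by congr (F (wedge _)); apply/ffunP => i; rewrite !ffunE phi1.
Qed.

Definition ffun_cons n (T : Type) (x : T) (a : {ffun 'I_n -> T}) :
  {ffun 'I_n.+1 -> T} := [ffun i => oapp a x (unlift ord0 i)].

Lemma ffun_cons0 n T x (a : {ffun 'I_n -> T}) : ffun_cons x a ord0 = x.
Proof. by rewrite ffunE unlift_none. Qed.

Lemma ffun_consS n T x (a : {ffun 'I_n -> T}) i :
  ffun_cons x a (lift ord0 i) = a i.
Proof. by rewrite ffunE liftK. Qed.

Section Contraction.
Variables (n : nat) (V : lmodType k) (x : V) (F : dual (ext_pow n.+1 V)).

Fact contract_alternating : alternating (fun a => F (wedge (ffun_cons x a))).
Proof.
have [mf af] := dual_wedge_alternating F.
have consE a i v :
    ffun_cons x (upd a i v) = upd (ffun_cons x a) (lift ord0 i) v.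
  apply/ffunP => j; rewrite updE.
  case: (unliftP ord0 j) => [j' ->|->]; last by rewrite !ffun_cons0.
  by rewrite !ffun_consS updE (inj_eq lift_inj).
split=> [a i c u v|a i j ij aij]; first by rewrite !consE mf.
by apply: (af _ (lift ord0 i) (lift ord0 j)); rewrite ?(inj_eq lift_inj) ?ffun_consS.
Qed.

Definition contract : dual (ext_pow n V) :=
  dual_of_alternating contract_alternating.

Lemma contractE a : contract (wedge a) = F (wedge (ffun_cons x a)).
Proof. exact: dual_of_alternatingE. Qed.
End Contraction.

Lemma ce_argsE (L : lieAlgType k) n (a : {ffun 'I_n.+1 -> L}) i j :
  ce_args a i j =
  ffun_seq n (lie (a i) (a j) ::
    [seq a l | l <- enum 'I_n.+1 & (l != i) && (l != j)]).
Proof. by []. Qed.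

Lemma ffun_cons_seq V n (x : V) s :
  ffun_cons x (ffun_seq n s) = ffun_seq n.+1 (x :: s).
Proof.
apply/ffunP => i; case: (unliftP ord0 i) => [i' ->|->].
  by rewrite ffun_consS !ffunE.
by rewrite ffun_cons0 ffunE.
Qed.

Lemma pullback_ce_diff (L L' : lieAlgType k) n (phi : {linear L -> L'})
    (F : cochain L' n) :
  (forall u v, phi (lie u v) = lie (phi u) (phi v)) ->
  ce_diff (pullback phi F) = pullback phi (ce_diff F).
Proof.
move=> morph; apply: dual_wedge_eq => a; rewrite pullbackE !ce_diffE /ce_sum.
apply: eq_bigr => i _; apply: eq_bigr => j ij; rewrite pullbackE.
congr (_ * F (wedge _)); apply/ffunP => m; rewrite !ffunE -morph.
case: (m : nat) => [//|d] /=.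
(* Past the end of the list both sides take the default value 0, which [phi] preserves. *)
elim: [seq l <- _ | _] d => [|l s IH] [|d] //=; rewrite ?linear0 //.
by rewrite ffunE.
Qed.

(** Evaluate [ce_diff F = 0] at (x, a_0, ..., a_n). The pairs containing index 0 give the Lie
    derivative along [x]; in the others [x] and [a_i, a_j] appear in the opposite order to the
    contraction, which costs a sign. *)
Lemma cartan_formula (L : lieAlgType k) n (F : cochain L n.+1) x a :
  ce_diff F = 0 ->
  ce_diff (contract x F) (wedge a) = - \sum_j F (wedge (upd a j (lie x (a j)))).
Proof.
move=> dF; have altF := dual_wedge_alternating F.
pose b := ffun_cons x a.
have b_others (P : pred 'I_n.+2) : [seq b l | l <- enum 'I_n.+2 & P l] =
    (if P ord0 then cons x else id)
      [seq a l | l <- enum 'I_n.+1 & P (lift ord0 l)].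
  have map_b s : [seq b l | l <- [seq lift ord0 l | l <- s]] = map a s.
    by rewrite -map_comp; apply: eq_map => l /=; rewrite /b ffun_consS.
  rewrite filter_enum_ord; case: (P ord0) => /=; rewrite map_b //.
  by rewrite /b ffun_cons0.
(* The pair (0, j+1) has sign (-1)^(j+1), and moving [x, a_j] past a_0, ..., a_(j-1) into slot j
   contributes (-1)^j. *)
have sum0 : \sum_(j < n.+2 | (0 < j)%N)
    (-1) ^+ j * F (wedge (ce_args b ord0 j)) =
    - \sum_j F (wedge (upd a j (lie x (a j)))).
  rewrite big_mkcond big_ord_recl /= add0r -sumrN; apply: eq_bigr => j _.
  rewrite ce_argsE b_others eqxx /b ffun_cons0 ffun_consS.
  rewrite [filter _ _](_ : _ = [seq l <- enum 'I_n.+1 | l != j]); last first.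
    by apply: eq_filter => l; rewrite (inj_eq lift_inj).
  rewrite filter_seq upd_seq; set s := [seq a l | l <- _].
  have szs : size (take j s) = j.
    by rewrite size_take size_map size_enum_ord ltn_ord.
  rewrite (alternating_move _ _ altF) szs // /bump /= exprS mulN1r mulNr.
  by congr (- _); apply: signrMK.
rewrite ce_diffE; have ce0 : ce_sum F b = 0 by rewrite -ce_diffE dF.
move: ce0; rewrite /ce_sum big_ord_recl /= sum0 => /eqP.
rewrite addrC addr_eq0 opprK => /eqP {}sum0.
rewrite -sum0 /ce_sum -sumrN; apply: eq_bigr => i _.
rewrite [in RHS]big_mkcond big_ord_recl /= add0r -big_mkcond -sumrN /=.
apply: eq_big => [j //|j ij].
(* A pair i < j forces [n] to be positive, so the argument tuple of [F] has the two slots to be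
   exchanged. *)
have n_gt0 : (0 < n)%N.
  by apply: leq_trans (leq_ltn_trans (leq0n i) ij) _; rewrite -ltnS.
rewrite -[ext_lift _ _]/(contract x F (wedge _)) contractE !ce_argsE.
rewrite b_others /b !(ffun_consS x a) ffun_cons_seq.
rewrite [in RHS](eq_filter (a2 := fun l => (l != i) && (l != j))); last first.
  by move=> l; rewrite !(inj_eq lift_inj).
rewrite -[x :: _]cat0s (alternating_swap _ _ _ altF) // mulrN.
by rewrite /bump /= !add1n addSn addnS !exprS !mulN1r opprK.
Qed.
End Cochains.

(** * Homotopy between the two ends of a linear family of Lie endomorphisms *)

Section Homotopy.
Variables (k : fieldType) (M : nat).
Hypothesis natr_neq0 : forall m, (0 < m <= M)%N -> m%:R != 0 :> k.

(** The nodes 1, ..., M are nonzero with nonzero differences, so their Vandermonde matrix is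
    invertible. *)
Lemma quadrature_weights : exists c : 'I_M -> k,
  forall m, (0 < m <= M)%N -> \sum_(s < M) c s * s.+1%:R ^+ m = m%:R^-1.
Proof using natr_neq0.
pose pt : 'rV[k]_M := \row_s s.+1%:R; pose V := Vandermonde M pt.
have unitV : V \in unitmx.
  rewrite unitmxE unitfE det_Vandermonde; apply/prodf_neq0 => i _.
  apply/prodf_neq0 => j ij; rewrite !mxE -natrB ?ltnS ?(ltnW ij) // subSS.
  by apply: natr_neq0; rewrite subn_gt0 ij (leq_trans (leq_subr _ _)) // ltnW.
pose w : 'cV[k]_M := \col_i i.+1%:R^-1; pose d := invmx V *m w.
(* Vandermonde rows carry the exponents 0, ..., M-1 while [m] runs over 1, ..., M; dividing by the
   node makes up for the shift. *)
exists (fun s => d s 0 / s.+1%:R) => -[//|m] /= ltmM.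
have := congr1 (fun A : 'cV_M => A (Ordinal ltmM) 0) (mulKVmx unitV w).
rewrite -/d /w !mxE /= => <-; apply: eq_bigr => s _; rewrite !mxE exprS mulrA.
by rewrite divfK 1?mulrC // natr_neq0 //= ltn_ord.
Qed.

Variables (L : lieAlgType k) (x : L) (D P : {linear L -> L}).
Variable rho : {linear L -> 'rV[k]_M}.

(** Under [D_lie] and [P_lie] below, [deformation t (lie x v)] is [t *: D v]: bracketing with [x]
    acts through the family as the Euler operator t d/dt. *)
Definition deformation (t : k) : {linear L -> L} := P \+ t \*: D.

Hypothesis DK : forall v, D (D v) = D v.
Hypothesis PD0 : forall v, P (D v) = 0.
Hypothesis D_lie : forall v, D (lie x v) = D v.
Hypothesis P_lie : forall v, P (lie x v) = 0.
Hypothesis deformation_lie : forall t u v,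
  deformation t (lie u v) = lie (deformation t u) (deformation t v).
Hypothesis rho_inj : forall v, rho (D v) = 0 -> D v = 0.

Lemma deformation_homotopy n (F : cochain L n.+1) : ce_diff F = 0 ->
  exists G : cochain L n,
    ce_diff G = pullback (deformation 1) F - pullback (deformation 0) F.
Proof using natr_neq0 DK PD0 D_lie P_lie deformation_lie rho_inj.
move=> dF; have [c cE] := quadrature_weights.
have defE t v : deformation t v = P v + t *: D v by [].
(* The minus sign cancels the one in [cartan_formula]. *)
exists (\sum_(s < M) - c s *: contract x (pullback (deformation s.+1%:R) F)).
rewrite linear_sum; apply/eqP; rewrite -subr_eq0; apply/eqP.
apply: dual_wedge_eq.
(* Since [D] is idempotent, it is enough to test tuples whose entries are each fixed or killed by
   [D]. On such a tuple only the number of fixed entries matters for the dependence on t. *)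
apply: (@multilinear_spanned _ _ _ _ _ (fun v => D v = v \/ D v = 0)).
- exact: (dual_wedge_alternating _).1.
- move=> v; have -> : v = 1 *: D v + (1 *: (v - D v) + 0).
    by rewrite !scale1r addr0 subrKC.
  apply: SpannedD; first by left.
  apply: SpannedD; last by constructor.
  by right; rewrite linearB /= DK subrr.
move=> a homog; pose S := [set i | D (a i) == a i].
pose b := ffun_comp (deformation 1) a.
have aS i : i \in S -> D (a i) = a i by rewrite inE => /eqP.
have aNS i : i \notin S -> D (a i) = 0.
  by rewrite inE; case: (homog i) => // ->; rewrite eqxx.
have aPS i : i \in S -> P (a i) = 0 by move=> /aS <-.
have altF := dual_wedge_alternating F; have mF := altF.1.
have defF t : F (wedge (ffun_comp (deformation t) a)) = t ^+ #|S| * F (wedge b).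
  rewrite -prodr_const big_mkcond /= -[RHS](multilinear_scale _ _ mF).
  congr (F (wedge _)); apply/ffunP => i; rewrite !ffunE !defE scale1r.
  case: ifPn => [iS|/aNS ->]; first by rewrite aPS // !add0r.
  by rewrite scaler0 addr0 scale1r.
(* In Cartan's formula an index in [S] reproduces the full term, and any other index puts a zero
   entry into the tuple; hence the factor [#|S|]. *)
have dG t : ce_diff (contract x (pullback (deformation t) F)) (wedge a) =
    - (#|S|%:R * (t ^+ #|S| * F (wedge b))).
  rewrite cartan_formula; last first.
    by rewrite pullback_ce_diff // dF linear0.
  congr (- _); rewrite mulr_natl -sumr_const [RHS]big_mkcond; apply: eq_bigr => j _.
  rewrite pullbackE; case: ifPn => jS.
    rewrite -defF; congr (F (wedge _)); apply/ffunP => i; rewrite !ffunE.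
    by case: eqP => // ->; rewrite !defE P_lie D_lie aPS.
  apply: (multilinear0 (i := j) mF).
  by rewrite !ffunE eqxx defE P_lie D_lie aNS // scaler0 addr0.
(* The entries of [b] with index in [S] lie in the image of [D], which [rho] embeds into row vectors
   of length [M]. *)
have Fb0 : (M < #|S|)%N -> F (wedge b) = 0.
  move=> ltMS; apply: (alternating_rank (rho := rho) altF ltMS) => e.
  have -> : \sum_(i in S) e i *: b i = D (\sum_(i in S) e i *: a i).
    rewrite linear_sum; apply: eq_bigr => i iS.
    by rewrite linearZ /= ffunE defE aPS // add0r scale1r aS.
  exact: rho_inj.
have pF t : pullback (deformation t) F (wedge a) = t ^+ #|S| * F (wedge b).
  by rewrite pullbackE defF.
rewrite 2!dualBE !pF dual_sumE.
have sumE : \sum_(s < M)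
    ce_diff (- c s *: contract x (pullback (deformation s.+1%:R) F)) (wedge a) =
    #|S|%:R * (\sum_(s < M) c s * s.+1%:R ^+ #|S|) * F (wedge b).
  rewrite mulr_sumr mulr_suml; apply: eq_bigr => s _.
  by rewrite linearZ dualZE dG mulrNN mulrCA !mulrA.
rewrite sumE => {sumE}.
(* If [S] is empty, 0^0 = 1 makes the two pullbacks agree, and the factor [#|S|%:R] kills the
   differential. *)
have [S0|S_gt0] := posnP #|S|; first by rewrite S0 !expr0 !mul0r !subrr.
rewrite expr1n mul1r expr0n gtn_eqF // mul0r subr0.
have [/Fb0 ->|leSM] := ltnP M #|S|; first by rewrite mulr0 subrr.
by rewrite cE ?S_gt0 // divff ?natr_neq0 ?S_gt0 // mul1r subrr.
Qed.
End Homotopy.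

(** * Row scalings and grading elements of the Borel subalgebra *)

Section Borel.
Variables (k : fieldType) (N : nat).
Implicit Types A B : borel k N.

Lemma borel_upper A (i j : 'I_N) : (j < i)%N -> (A : 'M_N) i j = 0.
Proof.
by case: A => A /= /andP[_ /is_trig_mxP uA] ji; have := uA j i ji; rewrite mxE.
Qed.

Lemma borel_tr A : \tr (A : 'M_N) = 0.
Proof. by case: A => A /= /andP[/eqP]. Qed.

Section RowScaling.
Variables (c : k) (g : 'I_N -> k).

(** One family for all the maps used below: erasing rows, extracting a row, and deforming a row off
    the diagonal. A common factor [c] on the diagonal keeps the trace zero. *)
Definition row_scale_mx (A : 'M[k]_N) : 'M[k]_N :=
  \matrix_(i, j) ((if i == j then c else g i) * A i j).

Fact row_scale_mx_borel A : row_scale_mx A \in @borel_mx k N.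
Proof.
apply/andP; split.
  have -> : row_scale_mx A \in @sl_mx k N = (\tr (row_scale_mx A) == 0) by [].
  rewrite -(mulr0 c) -(borel_tr A) mulr_sumr; apply/eqP/eq_bigr => i _.
  by rewrite mxE eqxx.
by apply/is_trig_mxP => i j ij; rewrite !mxE borel_upper ?mulr0.
Qed.

Definition row_scale A : borel k N := Borel (row_scale_mx_borel A).

Fact row_scale_linear : linear row_scale.
Proof.
by move=> a A B; apply/val_inj/matrixP => i j; rewrite !mxE mulrDr mulrCA.
Qed.

HB.instance Definition _ :=
  GRing.isLinear.Build k (borel k N) (borel k N) _ row_scale row_scale_linear.

Lemma row_scaleE A i j :
  (row_scale A : 'M_N) i j = (if i == j then c else g i) * (A : 'M_N) i j.
Proof. by rewrite mxE. Qed.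
End RowScaling.

(** Already the matrix product is respected. In an off-diagonal entry (i, j), the terms l = i and l
    = j carry a single factor [g i], those with i < l < j carry [g i * g l], and all others vanish
    by triangularity. *)
Lemma row_scale_lie g : (forall i l : 'I_N, (i < l)%N -> g i * g l = g i) ->
  forall A B, row_scale 1 g (lie A B) = lie (row_scale 1 g A) (row_scale 1 g B).
Proof.
move=> gg; have mulE A B i j :
    \sum_l (row_scale 1 g A : 'M_N) i l * (row_scale 1 g B : 'M_N) l j =
    (if i == j then 1 else g i) * \sum_l (A : 'M_N) i l * (B : 'M_N) l j.
  rewrite mulr_sumr; apply: eq_bigr => l _; rewrite !row_scaleE.
  case: (ltngtP l i) => [li|il|/val_inj ->].
  - by rewrite borel_upper // !(mulr0, mul0r).
  - have -> : i == l = false by rewrite -val_eqE ltn_eqF.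
    case: (eqVneq l j) => [<-|_].
      by rewrite -val_eqE ltn_eqF // mul1r mulrA.
    case: eqP => [<-|_]; first by rewrite (borel_upper B il) !mulr0.
    by rewrite mulrACA gg.
  - by rewrite eqxx mul1r mulrCA.
move=> A B; apply/val_inj/matrixP => i j.
by rewrite /= !mxE mulE mulE mulrBr.
Qed.

Section Row.
Hypothesis natr_neq0 : forall m, (0 < m <= N)%N -> m%:R != 0 :> k.
Variable r : 'I_N.

(** Subtracting the scalar 1/N makes the trace zero and does not affect brackets. *)
Definition row_grading_mx : 'M[k]_N :=
  diag_mx (\row_i ((i == r)%:R - N%:R^-1)).

Fact row_grading_borel : row_grading_mx \in @borel_mx k N.
Proof using natr_neq0.
apply/andP; split; last by rewrite tr_diag_mx diag_mx_is_trig.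
apply/eqP; rewrite mxtrace_diag.
under eq_bigr => i _ do rewrite mxE.
rewrite sumrB sumr_const card_ord (bigD1 r) //= eqxx big1 => [|i /negPf-> //].
rewrite addr0 -[_^-1 *+ _]mulr_natr mulVf ?subrr // natr_neq0 // leqnn andbT.
exact: leq_trans (ltn_ord r).
Qed.

Definition row_grading : borel k N := Borel row_grading_borel.

(** Off the diagonal the eigenvalue is 1 on row [r] and -1 on column [r]; by triangularity the
    latter entries can be nonzero only in the rows above [r], which the deformations erase. *)
Lemma row_grading_lie A i j : (lie row_grading A : 'M_N) i j =
  ((i == r)%:R - (j == r)%:R) * (A : 'M_N) i j.
Proof.
rewrite /= /lie /= /mx_lie /row_grading_mx mul_diag_mx mul_mx_diag !mxE.
by rewrite [X in _ - X]mulrC -mulrBl opprB addrA subrK.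
Qed.
End Row.
End Borel.

(** * Retraction onto the Cartan subalgebra and the induced isomorphism *)

Section Retraction.
Variables (k : fieldType) (N : nat).
Hypothesis natr_neq0 : forall m, (0 < m <= N)%N -> m%:R != 0 :> k.

(** Interpolates between the identity at [r = 0] and the projection onto the diagonal matrices at
    [r = N]. *)
Definition kill_rows (r : nat) : {linear borel k N -> borel k N} :=
  row_scale 1 (fun i : 'I_N => (r <= i)%:R).

Definition row_part (r : 'I_N) : {linear borel k N -> borel k N} :=
  row_scale 0 (fun i : 'I_N => (i == r)%:R).

Lemma kill_row_homotopy (r : 'I_N) n (F : cochain (borel k N) n.+1) :
  ce_diff F = 0 -> exists G : cochain (borel k N) n,
    ce_diff G = pullback (kill_rows r) F - pullback (kill_rows r.+1) F.
Proof using natr_neq0.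
move=> dF; pose D := row_part r; pose P := kill_rows r.+1.
(* The factor is 0 above row [r], [t] on it and 1 below, so t = 1 gives [kill_rows r] and t = 0
   gives [kill_rows r.+1]. *)
pose g t (i : 'I_N) : k := (r < i)%:R + t * (i == r)%:R.
have defE t : deformation D P t =1 row_scale 1 (g t).
  move=> A; rewrite [LHS](_ : _ = P A + t *: D A) //.
  apply/val_inj/matrixP => i j; rewrite !mxE mulrA -mulrDl.
  by case: ifP => _; rewrite ?mulr0 ?addr0.
have g1 i : g 1 i = (r <= i)%:R.
  rewrite /g mul1r -val_eqE /=.
  by case: ltngtP; rewrite ?addr0 ?add0r.
have g0 i : g 0 i = (r < i)%:R by rewrite /g mul0r addr0.
pose row_r : {linear borel k N -> 'rV[k]_N} := row r \o val.
have [] := @deformation_homotopy k N natr_neq0 (borel k N)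
  (row_grading natr_neq0 r) D P row_r _ _ _ _ _ _ n F dF.
- move=> A; apply/val_inj/matrixP => i j; rewrite !mxE.
  by case: (i == j); case: (i == r); rewrite ?mul0r ?mul1r.
- move=> A; apply/val_inj/matrixP => i j; rewrite !mxE.
  case: (i == j); rewrite ?mul0r ?mulr0 //.
  by case: eqP => [->|_]; rewrite ?ltnn ?mul0r ?mulr0.
- move=> A; apply/val_inj/matrixP => i j; rewrite row_scaleE row_grading_lie mxE.
  case: (eqVneq i j) => [_|nij]; first by rewrite !mul0r.
  case: (eqVneq i r) => [ir|_]; last by rewrite !mul0r.
  by rewrite -ir [j == i]eq_sym (negPf nij) subr0 !mul1r.
(* Below row [r] the eigenvalue is nonzero only in column [r], where an upper triangular matrix has
   zero entries. *)
- move=> A; apply/val_inj/matrixP => i j; rewrite row_scaleE row_grading_lie mxE.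
  case: eqP => [->|_]; first by rewrite subrr mul0r mulr0.
  case: (ltnP r i) => [ri|_]; last by rewrite mul0r.
  rewrite -[i == r]val_eqE gtn_eqF // sub0r.
  by case: eqP => [->|_]; rewrite ?(borel_upper A ri) ?oppr0 ?mul0r ?mulr0.
(* For i < l, either i < r and [g t i] is 0, or l > r and [g t l] is 1. *)
- move=> t A B; rewrite !defE row_scale_lie // => i l il.
  rewrite /g -!val_eqE /=; case: (ltngtP i r) => [ir|ri|ri].
  + by rewrite mulr0 addr0 mul0r.
  + by rewrite (ltn_trans ri il) (gtn_eqF (ltn_trans ri il)) mulr0 addr0 mulr1.
  + by rewrite -ri il (gtn_eqF il) mulr0 addr0 mulr1.
- move=> A DA0; apply/val_inj/matrixP => i j; rewrite row_scaleE mxE.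
  have := congr1 (fun v : 'rV_N => v 0 j) DA0; rewrite !mxE /=.
  case: (eqVneq i r) => [->|_]; first by rewrite eqxx.
  by move=> _; case: (i == j); rewrite mul0r.
move=> G dG; exists G; rewrite dG; congr (_ - _); apply: eq_pullback => A;
  rewrite defE; by apply/val_inj/matrixP => i j; rewrite !mxE ?g1 ?g0.
Qed.

(** The primitives found for single rows telescope, starting from the identity [kill_rows 0]. *)
Lemma kill_rows_homotopy r n (F : cochain (borel k N) n.+1) :
  (r <= N)%N -> ce_diff F = 0 ->
  exists G : cochain (borel k N) n, ce_diff G = F - pullback (kill_rows r) F.
Proof using natr_neq0.
move=> + dF; elim: r => [_|r IH ltrN].
  exists 0; rewrite linear0 pullback_id ?subrr // => A.
  by apply/val_inj/matrixP => i j; rewrite mxE; case: eqP; rewrite mul1r.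
have [G dG] := IH (ltnW ltrN).
have [H dH] := kill_row_homotopy (Ordinal ltrN) dF.
exists (G + H); rewrite linearD /= dG dH addrA.
by rewrite subrK.
Qed.

Definition diag_part (A : 'M[k]_N) : 'M[k]_N :=
  \matrix_(i, j) ((i == j)%:R * A i j).

Fact diag_part_cartan (A : borel k N) : diag_part A \in @cartan_mx k N.
Proof.
apply/andP; split.
  have -> : diag_part A \in @sl_mx k N = (\tr (diag_part A) == 0) by [].
  rewrite -(borel_tr A); apply/eqP/eq_bigr => i _.
  by rewrite mxE eqxx mul1r.
by apply/is_diag_mxP => i j ij; rewrite mxE (negPf (ij : i != j)) mul0r.
Qed.

Definition to_cartan (A : borel k N) : cartan k N := Cartan (diag_part_cartan A).

Fact to_cartan_linear : linear to_cartan.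
Proof.
by move=> a A B; apply/val_inj/matrixP => i j; rewrite !mxE mulrDr mulrCA.
Qed.

HB.instance Definition _ :=
  GRing.isLinear.Build k (borel k N) (cartan k N) _ to_cartan to_cartan_linear.

Fact cartan_borel (A : cartan k N) : (A : 'M_N) \in @borel_mx k N.
Proof.
case: A => A /= /andP[trA /is_diag_mxP diagA]; apply/andP; split=> //.
by apply/is_trig_mxP => i j ij; rewrite mxE diagA // gtn_eqF.
Qed.

Definition of_cartan (A : cartan k N) : borel k N := Borel (cartan_borel A).

Fact of_cartan_linear : linear of_cartan.
Proof. by move=> a A B; apply/val_inj. Qed.

HB.instance Definition _ :=
  GRing.isLinear.Build k (cartan k N) (borel k N) _ of_cartan of_cartan_linear.

Lemma of_cartanK A : to_cartan (of_cartan A) = A.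
Proof.
case: A => A /= cA; have /andP[_ /is_diag_mxP diagA] := cA.
apply/val_inj/matrixP => i j; rewrite mxE /=.
by case: (eqVneq i j) => [_|ij]; rewrite ?mul1r // mul0r diagA.
Qed.

(** By triangularity only l = i contributes to a diagonal entry of either product. Thus [to_cartan]
    is a Lie morphism when the Cartan subalgebra is regarded as abelian. *)
Lemma to_cartan_lie A B : to_cartan (lie A B) = 0.
Proof.
apply/val_inj/matrixP => i j; rewrite mxE [RHS]mxE.
case: eqP => [<-|_]; last by rewrite mul0r.
rewrite mul1r !mxE -sumrB big1 // => l _.
case: (ltngtP l i) => [li|il|/val_inj ->].
- by rewrite (borel_upper A li) (borel_upper B li) !mul0r subrr.
- by rewrite (borel_upper A il) (borel_upper B il) !mulr0 subrr.
- by rewrite mulrC subrr.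
Qed.

Lemma of_cartan_lie A B : lie (of_cartan A) (of_cartan B) = 0.
Proof.
have /andP[_ /is_diag_mxP dA] := valP A.
have /andP[_ /is_diag_mxP dB] := valP B.
apply/val_inj/matrixP => i j; rewrite !mxE -sumrB big1 //= => l _.
have [<-|il] := eqVneq i l; last by rewrite (dA i l) // (dB i l) // !mul0r subrr.
have [<-|ij] := eqVneq i j; first by rewrite mulrC subrr.
by rewrite (dA i j) // (dB i j) // !mulr0 subrr.
Qed.

Lemma of_to_cartan A : of_cartan (to_cartan A) = kill_rows N A.
Proof.
apply/val_inj/matrixP => i j; rewrite !mxE leqNgt ltn_ord.
by case: (i == j).
Qed.

Lemma inflation_cocycle n (G : dual (ext_pow n (cartan k N))) :
  ce_diff (pullback to_cartan G : cochain (borel k N) n) = 0.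
Proof.
apply: dual_wedge_eq => a; rewrite ce_diffE /ce_sum big1 // => i _.
(* In degree 0 there is no pair i < j; in higher degrees the bracket occupies slot [ord0]. *)
case: n G a i => [|n] G a i; first by rewrite big1 // => j; rewrite !ord1.
apply: big1 => j _; rewrite pullbackE.
rewrite (multilinear0 (i := ord0) (dual_wedge_alternating G).1) ?mulr0 //.
by rewrite !ffunE /= to_cartan_lie.
Qed.

(** Diagonal matrices commute, so every bracket in the differential vanishes. Hence coboundaries
    restrict to 0. *)
Lemma restriction_ce_diff n (F : cochain (borel k N) n) :
  pullback of_cartan (ce_diff F) = 0.
Proof.
apply: dual_wedge_eq => a; rewrite pullbackE ce_diffE /ce_sum big1 // => i _.
case: n F a i => [|n] F a i; first by rewrite big1 // => j; rewrite !ord1.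
apply: big1 => j _.
rewrite (multilinear0 (i := ord0) (dual_wedge_alternating F).1) ?mulr0 //.
by rewrite !ffunE /= of_cartan_lie.
Qed.

Lemma restriction_inflation n (G : dual (ext_pow n (cartan k N))) :
  pullback of_cartan (pullback to_cartan G) = G.
Proof.
apply: dual_wedge_eq => a; rewrite 2!pullbackE; congr (G (wedge _)).
by apply/ffunP => i; rewrite !ffunE /= of_cartanK.
Qed.

Lemma inflation_restriction n (F : cochain (borel k N) n) :
  pullback to_cartan (pullback of_cartan F) = pullback (kill_rows N) F.
Proof. by apply: pullback_comp => A; apply: of_to_cartan. Qed.

Lemma restriction_coboundary n (z : cocycle (borel k N) n) :
  z \in @is_coboundary k (borel k N) n -> pullback of_cartan z = 0.
Proof.
case: n z => [|n] z; first by move=> /eqP ->; apply: linear0.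
by move=> /asboolP[F <-]; apply: restriction_ce_diff.
Qed.

(** Computed on the chosen representative; [restriction_pi] shows that the choice does not
    matter. *)
Definition restriction n (q : lie_cohomology (borel k N) n) :
    dual (ext_pow n (cartan k N)) :=
  pullback of_cartan (quotmod_repr q : cocycle (borel k N) n).

Lemma restriction_pi n (z : cocycle (borel k N) n) :
  restriction (quotmod_pi _ z) = pullback of_cartan z.
Proof.
apply/eqP; rewrite -subr_eq0 -linearB; apply/eqP.
apply: (restriction_coboundary (z := quotmod_repr _ - z)).
rewrite -(quotmod_piE (@is_coboundary_submod_closed k (borel k N) n)).
by rewrite quotmod_reprK.
Qed.

Fact restriction_linear n : linear (@restriction n).
Proof.
move=> c p q; have [x ->] := quotmod_pi_surj p; have [y ->] := quotmod_pi_surj q.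
by rewrite -linearP !restriction_pi -linearP.
Qed.

HB.instance Definition _ n := GRing.isLinear.Build k
  (lie_cohomology (borel k N) n) (dual (ext_pow n (cartan k N))) _
  (@restriction n) (@restriction_linear n).

Definition inflation n (G : dual (ext_pow n (cartan k N))) :
    lie_cohomology (borel k N) n :=
  quotmod_pi _ (Cocycle (introT eqP (inflation_cocycle G))).

Lemma inflationK n : cancel (@inflation n) (@restriction n).
Proof.
by move=> G; rewrite restriction_pi restriction_inflation.
Qed.

(** Inflating the restriction is pulling back along [kill_rows N], which changes a cocycle of
    positive degree by a coboundary according to [kill_rows_homotopy]. *)
Lemma restrictionK n : cancel (@restriction n) (@inflation n).
Proof using natr_neq0.
move=> q; have [z ->] := quotmod_pi_surj q; rewrite restriction_pi.
apply/eqP; rewrite eq_sym quotmod_piE.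
have zE :
    \val (z - Cocycle (introT eqP (inflation_cocycle (pullback of_cartan z)))) =
    \val z - pullback (kill_rows N) (\val z).
  by rewrite -inflation_restriction.
case: n q z zE => [|n] q z zE.
  (* In degree 0 only 0 is a coboundary; the empty tuple is the only one, so pulling back changes
     nothing. *)
  apply/eqP/val_inj; rewrite zE; apply: dual_wedge_eq => a.
  rewrite dualBE pullbackE [ffun_comp _ _](_ : _ = a) ?subrr //.
  by apply/ffunP; case.
apply/asboolP; rewrite zE.
by apply: kill_rows_homotopy => //; apply/eqP/(valP z).
Qed.

End Retraction.

Theorem theorem2 (N : nat) (k : fieldType) (n : nat)
  (hN : (2 <= N)%N)
  (hk : forall p : nat, p \in [pchar k] -> (N < p)%N) :
  lmod_iso (lie_cohomology (borel k N) n) (dual (ext_pow n (cartan k N))).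
Proof.
(* If m vanished in k, the characteristic would be a prime dividing m, hence at most N, against
   [hk]. *)
have natr_neq0 m : (0 < m <= N)%N -> m%:R != 0 :> k.
  case/andP=> m_gt0 lemN; apply/negP => m0.
  have [p charp] := natf0_pchar m_gt0 m0.
  move: m0; rewrite -(dvdn_pcharf charp) => /(dvdn_leq m_gt0) lepm.
  by have := leq_trans (hk p charp) (leq_trans lepm lemN); rewrite ltnn.
exists (@restriction k N n : {linear _ -> _}).
by exists (@inflation k N n); [apply: restrictionK | apply: inflationK].
Qed.
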